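(* Let $A\subseteq\mathbb{R}$ be an open invex set with respect to $\eta:A\times A\to\mathbb{R}$ and let $a,b\in A$ with $a<a+\eta(b,a)$. Let $f:A\to\mathbb{R}$ be differentiable with $f'\in L[a,a+\eta(b,a)]$, and suppose $|f'|^q$ is preinvex on $A$ for some fixed $q>1$. Let $\frac1p+\frac1q=1$ and $\alpha>0$. Then \[ \left|\frac{f(a)+f(a+\eta(b,a))}{2}-\frac{\Gamma(\alpha+1)}{2\eta^{\alpha}(b,a)}\Big[J_{a^+}^{\alpha}f\big(a+\eta(b,a)\big)+J_{(a+\eta(b,a))^-}^{\alpha}f(a)\Big]\right|\le\frac{\eta(b,a)}{\alpha+1}\left(1-\frac{1}{2^{\alpha}}\right)\left[\frac{|f'(a)|^q+|f'(b)|^q}{2}\right]^{1/q}. \]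
   Context: A set $A\subseteq\mathbb{R}$ is invex with respect to $\eta:A\times A\to\mathbb{R}$ if $x+t\eta(y,x)\in A$ for all $x,y\in A$ and $t\in[0,1]$. A function $g$ on an invex set $A$ is preinvex with respect to $\eta$ if $g(x+t\eta(y,x))\le(1-t)g(x)+tg(y)$ for all $x,y\in A$, $t\in[0,1]$. For $g\in L[c,d]$ and $\alpha>0$, the Riemann–Liouville fractional integrals are $J_{c^+}^{\alpha}g(x)=\frac{1}{\Gamma(\alpha)}\int_c^x(x-t)^{\alpha-1}g(t)\,dt$ for $x>c$ and $J_{d^-}^{\alpha}g(x)=\frac{1}{\Gamma(\alpha)}\int_x^d(t-x)^{\alpha-1}g(t)\,dt$ for $x<d$; $\eta^{\alpha}(b,a)=(\eta(b,a))^{\alpha}$. *)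

(* Defs.v *)
From mathcomp Require Import all_boot all_order all_algebra.
From mathcomp Require Import all_classical all_reals all_analysis.
Set Implicit Arguments. Unset Strict Implicit. Unset Printing Implicit Defensive.
Import Order.TTheory GRing.Theory Num.Theory.
Import numFieldNormedType.Exports.
Local Open Scope classical_set_scope.
Local Open Scope ring_scope.

Definition Gamma (R : realType) (a : R) : R :=
  Rintegral (@lebesgue_measure R) `]0, +oo[
    (fun t => powR t (a - 1) * expR (- t)).

Definition RL_left (R : realType) (alpha c : R) (g : R -> R) (x : R) : R :=
  (Gamma alpha)^-1 *
  Rintegral (@lebesgue_measure R) `[c, x] (fun t => powR (x - t) (alpha - 1) * g t).

Definition RL_right (R : realType) (alpha d : R) (g : R -> R) (x : R) : R :=
  (Gamma alpha)^-1 *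
  Rintegral (@lebesgue_measure R) `[x, d] (fun t => powR (t - x) (alpha - 1) * g t).

Definition invex (R : realType) (A : set R) (eta : R -> R -> R) : Prop :=
  forall x y t, A x -> A y -> 0 <= t <= 1 -> A (x + t * eta y x).

Definition preinvex (R : realType) (A : set R) (eta : R -> R -> R) (g : R -> R) : Prop :=
  forall x y t, A x -> A y -> 0 <= t <= 1 ->
    g (x + t * eta y x) <= (1 - t) * g x + t * g y.

(* Main.v *)
Require Import Defs.
From HB Require Import structures.
From mathcomp Require Import all_boot all_order all_algebra.
From mathcomp Require Import all_classical all_reals all_analysis.
From mathcomp Require Import measurable_realfun ring lra.
Import Order.TTheory GRing.Theory Num.Theory.
Import numFieldNormedType.Exports.
Local Open Scope classical_set_scope.
Local Open Scope ring_scope.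

(** With e = eta b a, the substitutions t = a + u and t = a + e - u turn the
    left-hand side into alpha / (2 e^alpha) times the integral over [0, e] of
    u^(alpha - 1) g(u), where g(u) = f(a) + f(a + e) - f(a + e - u) - f(a + u).
    Preinvexity at the parameters u / e and 1 - u / e and the power mean
    inequality bound |f'(a + u)| + |f'(a + e - u)| by 2 K, with K the q-mean of
    |f'(a)| and |f'(b)|.  So |g'| <= 2 K, and the mean value theorem together
    with g(0) = 0 and the symmetry g(e - u) = g(u) give
    |g(u)| <= 2 K min(u, e - u).  Integrating against u^(alpha - 1) yields the
    constant exactly.  No fundamental theorem of calculus for the possibly
    discontinuous f' is involved. *)

(** * Improper integrals as limits over growing segments *)

Section improper_integrals.
Set Implicit Arguments.
Unset Strict Implicit.
Context {R : realType}.
Implicit Types (F f : R -> R) (e s t x y : R).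
Local Notation mu := (@lebesgue_measure R).

Lemma derivable_within_itv f x y :
  (forall t, x <= t <= y -> derivable f t 1) -> {within `[x, y], continuous f}.
Proof.
by move=> df; apply: derivable_within_continuous => t; rewrite in_itv/= => /df.
Qed.

Lemma measurable_derivable f x y :
  (forall t, x <= t <= y -> derivable f t 1) -> measurable_fun `[x, y] f.
Proof.
move=> df; apply: subspace_continuous_measurable_fun => //.
exact: derivable_within_itv.
Qed.

(** Fundamental theorem of calculus in the form used below for explicit antiderivatives:
    derivability of [f] supplies the continuity of the integrand, and derivability of [F] at the
    endpoints supplies the one-sided limits. *)
Lemma integral_is_derive F f x y : x < y ->
  (forall t, x <= t <= y -> is_derive t 1 F (f t)) ->
  (forall t, x <= t <= y -> derivable f t 1) ->
  (\int[mu]_(t in `[x, y]) (f t)%:E = (F y - F x)%:E)%E.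
Proof.
move=> xy dF df; rewrite EFinB; apply: continuous_FTC2 => //.
- exact: derivable_within_itv.
- split.
  + move=> t; rewrite in_itv/= => /andP[xt ty].
    by have [] : is_derive t 1 F (f t) by apply: dF; rewrite !ltW.
  + apply: cvg_at_right_filter; apply: differentiable_continuous.
    apply/derivable1_diffP.
    by have [] : is_derive x 1 F (f x) by apply: dF; rewrite lexx ltW.
  + apply: cvg_at_left_filter; apply: differentiable_continuous.
    apply/derivable1_diffP.
    by have [] : is_derive y 1 F (f y) by apply: dF; rewrite lexx ltW.
- move=> t; rewrite in_itv/= => /andP[xt ty].
  have dFt : is_derive t 1 F (f t) by apply: dF; rewrite !ltW.
  by rewrite derive1E derive_val.
Qed.

Lemma itv_integrable f x y : (forall t, x <= t <= y -> derivable f t 1) ->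
  mu.-integrable `[x, y] (EFin \o f).
Proof.
move=> df; apply: continuous_compact_integrable; first exact: segment_compact.
exact: derivable_within_itv.
Qed.

(** Monotone convergence. It reduces an integral whose integrand may be singular at an end, or whose
    domain is unbounded, to segments where the integrand is smooth. *)
Lemma cvg_integral_itv_bigcup (u v : nat -> R) f :
  nonincreasing_seq u -> nondecreasing_seq v ->
  (forall n t, u n <= t <= v n -> 0 <= f t) ->
  (forall n t, u n <= t <= v n -> derivable f t 1) ->
  (\int[mu]_(t in `[u n, v n]) (f t)%:E @[n --> \oo] -->
   \int[mu]_(t in \bigcup_n `[u n, v n]%classic) (f t)%:E)%E.
Proof.
move=> du iv f0 df; apply: ge0_nondecreasing_set_cvg_integral => //.
- move=> m n mn; rewrite subsetEset => t; rewrite /= !in_itv/= => /andP[ut tv].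
  by rewrite (le_trans (du _ _ mn) ut) (le_trans tv (iv _ _ mn)).
- by move=> n; apply/measurable_EFinP; exact: measurable_derivable (df n).
Qed.

Lemma derivable_powRr s t : 0 < t -> derivable (fun x => powR x s) t 1.
Proof. by move=> t0; have [] := is_derive1_powR s t0. Qed.

Lemma is_derive_powR_div s t : s != 0 -> 0 < t ->
  is_derive t 1 (fun x => powR x s / s) (powR t (s - 1)).
Proof.
move=> s0 t0; have dp := is_derive1_powR s t0.
apply: is_derive_eq; rewrite scaler0 add0r.
by rewrite /GRing.scale/= mulrA mulVf// mul1r.
Qed.

Lemma cvg_invSS : (n.+2%:R^-1 : R) @[n --> \oo] --> (0 : R).
Proof. by have := @cvg_harmonic R; rewrite -[X in X -> _]cvg_shiftS. Qed.

(** The divisor starts at 2, so that even the first segment is nondegenerate, as the strict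
    inequality in [integral_is_derive] demands. *)
Lemma itv0_bigcup e : 0 < e ->
  `]0, e]%classic = \bigcup_n `[(e / n.+2%:R : R), e]%classic.
Proof.
move=> e0; apply/seteqP; split => t /=.
  rewrite in_itv/= => /andP[t0 te].
  have /cvgrPdist_lt/(_ _ (divr_gt0 t0 e0))[n _ nP] := cvg_invSS.
  exists n => //=; rewrite in_itv/= te andbT ltW//.
  have := nP n (leqnn _); rewrite /= sub0r normrN ger0_norm ?invr_ge0//.
  by rewrite ltr_pdivlMr// mulrC.
case=> n _; rewrite /= !in_itv/= => /andP[ut ->]; rewrite andbT.
by rewrite (lt_le_trans _ ut)// divr_gt0.
Qed.

Lemma integral_powR s e : 0 < s -> 0 < e ->
  (\int[mu]_(t in `[0%R, e]) (powR t (s - 1))%:E = (powR e s / s)%:E)%E.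
Proof.
move=> s0 e0; rewrite -integral_itv_obnd_cbnd; last first.
  by apply/measurable_EFinP/measurable_funTS; exact: measurable_powR.
pose u n : R := e / n.+2%:R.
have u0 n : 0 < u n by rewrite divr_gt0.
have cvgI : (\int[mu]_(t in `[u n, e]) (powR t (s - 1))%:E @[n --> \oo] -->
    \int[mu]_(t in `]0%R, e]) (powR t (s - 1))%:E)%E.
  rewrite itv0_bigcup//; apply: (@cvg_integral_itv_bigcup u (fun=> e)) => //.
  - by move=> m n mn; rewrite ler_pM2l// lef_pV2 ?posrE// ler_nat.
  - by move=> n t _; exact: powR_ge0.
  - by move=> n t /andP[/(lt_le_trans (u0 n)) + _]; exact: derivable_powRr.
apply: (cvg_unique _ cvgI) => //.
rewrite (_ : (fun n => _) = fun n => (powR e s / s - powR (u n) s / s)%:E).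
  apply: cvg_EFin; first by apply: nearW => n.
  rewrite -[X in _ --> X]subr0; apply: cvgB; first exact: cvg_cst.
  rewrite -(mul0r s^-1); apply: cvgMl.
  (* The boundary term at the lower end vanishes in the limit because [s > 0]. *)
  have /cvg_at_rightP := powR_cvg0 s0; apply.
  by split => //; rewrite -(mulr0 e); apply: cvgMr; exact: cvg_invSS.
apply/funext => n; apply: (@integral_is_derive (fun t => powR t s / s)).
- by rewrite gtr_pMr// invf_lt1// ltr1n.
- move=> t /andP[/(lt_le_trans (u0 n)) + _]; apply: is_derive_powR_div.
  by rewrite gt_eqF.
- by move=> t /andP[/(lt_le_trans (u0 n)) + _]; exact: derivable_powRr.
Qed.

End improper_integrals.

(** * The Gamma function: finiteness, positivity, functional equation *)

Section gamma.
Set Implicit Arguments.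
Unset Strict Implicit.
Context {R : realType}.
Implicit Types (s t x y : R) (n : nat).
Local Notation mu := (@lebesgue_measure R).

(* This makes t^(s-1) e^(-t) at most a multiple of the derivative of the
   bounded function -1/(1 + t^s), so that Gamma converges at both ends at once;
   it also controls the boundary term t^s e^(-t) at infinity. *)
Lemma sqr_1DpowR_le_expR s : 0 < s ->
  exists2 C, 0 < C & forall t, 0 < t -> (1 + powR t s) ^+ 2 <= C * expR t.
Proof.
move=> s0; pose N := Num.trunc (s * 2).
have sN : s * 2 <= N.+1%:R by rewrite ltW// truncnS_gt.
have fact1 : 1 <= N.+1`!%:R :> R by rewrite ler1n fact_gt0.
(* For [t <= 1] the square is at most 4. For [t >= 1] it is at most 4 t^(2s) <= 4 t^(N+1), and the
   exponential series gives t^(N+1) <= (N+1)! e^t. *)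
exists (4 * N.+1`!%:R) => [|t t0]; first by nra.
have [t1|t1] := leP t 1.
  have : powR t s <= 1 by rewrite -[leRHS](congr1 (@^~ s) (powR1 R));
    apply: ge0_ler_powR => //; rewrite ?nnegrE ltW.
  have := powR_ge0 t s; have : 1 <= expR t by rewrite -expR0 ler_expR ltW.
  by move: fact1; set F := N.+1`!%:R; nra.
have ts1 : 1 <= powR t s.
  by rewrite -(powRr0 t) ler_powR ?ltW.
have ts2 : (powR t s) ^+ 2 <= N.+1`!%:R * expR t.
  rewrite -powR_mulrn ?powR_ge0// -powRrM.
  rewrite (le_trans (ler_powR (ltW t1) sN))// powR_mulrn ?(ltW t0)//.
  have := expR_ge1Dxn N (ltW t0); rewrite -ler_pdivrMl; last by nra.
  by rewrite mulrC; lra.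
by nra.
Qed.

Lemma is_derive_expRN t : is_derive t 1 (fun x => expR (- x)) (- expR (- t)).
Proof.
have dN : is_derive t 1 (fun x : R => - x) (- 1) by apply: is_deriveN.
by have := is_derive1_comp (is_derive_expR (- t)) dN; rewrite mulrN1.
Qed.

Lemma derivable_powR_expRN s t : 0 < t ->
  derivable (fun x => powR x s * expR (- x)) t 1.
Proof.
move=> t0; apply: derivableM; first exact: derivable_powRr.
by have [] := is_derive_expRN t.
Qed.

Lemma is_derive_powR_expRN s t : 0 < t ->
  is_derive t 1 (fun x => powR x s * expR (- x))
    (s * (powR t (s - 1) * expR (- t)) - powR t s * expR (- t)).
Proof.
move=> t0; have de := is_derive_expRN t; have dp := is_derive1_powR s t0.
apply: is_derive_eq; rewrite /GRing.scale/=; ring.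
Qed.

Lemma is_derive_V1DpowR s t : 0 < t ->
  is_derive t 1 (fun x => - (1 + powR x s)^-1)
    (s * powR t (s - 1) / (1 + powR t s) ^+ 2).
Proof.
move=> t0; have dp := is_derive1_powR s t0.
have p0 : 1 + powR t s != 0 by rewrite gt_eqF// ltr_pwDl// powR_ge0.
have d1 : is_derive t 1 (fun x => 1 + powR x s) (s * powR t (s - 1)).
  by have := is_deriveD (is_derive_cst (1 : R) t 1) dp; rewrite add0r.
have := is_deriveN (@is_deriveV _ (fun x => 1 + powR x s) _ _ _ p0 d1).
by rewrite scaleNr opprK /GRing.scale/= mulrC.
Qed.

Lemma derivable_dV1DpowR s t : 0 < t ->
  derivable (fun x => s * powR x (s - 1) / (1 + powR x s) ^+ 2) t 1.
Proof.
move=> t0; have dV : derivable (fun x => (1 + powR x s) ^+ 2) t 1.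
  have dp := is_derive1_powR s t0.
  have d1 : derivable (fun x => 1 + powR x s) t 1.
    by have [] := is_deriveD (is_derive_cst (1 : R) t 1) dp.
  by rewrite (_ : (fun x => _) = (fun x => (1 + powR x s) * (1 + powR x s)));
    [exact: derivableM|apply/funext => x; rewrite expr2].
have p0 : (1 + powR t s) ^+ 2 != 0.
  by rewrite expf_neq0// gt_eqF// ltr_pwDl// powR_ge0.
apply: derivableM; last exact: (@derivableV _ _ (fun x => (1 + powR x s) ^+ 2)).
apply: derivableM; first exact: derivable_cst.
exact: derivable_powRr.
Qed.

Lemma itv_gt0_bigcup :
  `]0, +oo[%classic = \bigcup_n `[(n.+2%:R^-1 : R), n.+2%:R]%classic.
Proof.
apply/seteqP; split => t /=.
  rewrite in_itv/= andbT => t0.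
  exists (maxn (Num.trunc t) (Num.trunc t^-1)) => //=; rewrite in_itv/=.
  set m := maxn _ _; have tm x : (Num.trunc x <= m)%N -> x <= m.+2%:R.
    move=> xm; rewrite (le_trans (ltW (truncnS_gt x)))// ler_nat ltnS.
    exact: leq_trans xm _.
  rewrite tm ?leq_maxl// andbT -[leRHS]invrK lef_pV2 ?posrE ?invr_gt0//.
  by rewrite tm ?leq_maxr.
case=> n _; rewrite /= !in_itv/= andbT => /andP[ut _].
by rewrite (lt_le_trans _ ut).
Qed.

Lemma invSS_lt n : n.+2%:R^-1 < n.+2%:R :> R.
Proof. by rewrite (@lt_trans _ _ 1)// ?ltr1n// invf_lt1// ltr1n. Qed.

Lemma invSS_gt0 n t : n.+2%:R^-1 <= t <= n.+2%:R -> 0 < t.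
Proof. by move=> /andP[ut _]; rewrite (lt_le_trans _ ut). Qed.

Lemma cvg_integral_powR_expRN s :
  (\int[mu]_(t in `[(n.+2%:R^-1)%R, n.+2%:R%R]) (powR t (s - 1) * expR (- t))%:E
     @[n --> \oo] -->
   \int[mu]_(t in `]0%R, +oo[) (powR t (s - 1) * expR (- t))%:E)%E.
Proof.
rewrite itv_gt0_bigcup.
apply: (@cvg_integral_itv_bigcup R (fun n => n.+2%:R^-1) (fun n => n.+2%:R)).
- by move=> m n mn; rewrite lef_pV2 ?posrE// ler_nat.
- by move=> m n mn; rewrite ler_nat.
- by move=> n t _; rewrite mulr_ge0 ?powR_ge0 ?expR_ge0.
- by move=> n t /invSS_gt0; exact: derivable_powR_expRN.
Qed.

(** The content is finiteness: [Rintegral] goes through [fine], which would send an infinite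
    integral to 0. All truncated integrals are bounded by the same number C / s. *)
Lemma EFin_Gamma s : 0 < s ->
  (\int[mu]_(t in `]0%R, +oo[) (powR t (s - 1) * expR (- t))%:E =
   (Gamma s)%:E)%E.
Proof.
move=> s0; rewrite /Gamma /Rintegral fineK// ge0_fin_numE; last first.
  by apply: integral_ge0 => t _; rewrite lee_fin mulr_ge0 ?powR_ge0 ?expR_ge0.
have [C C0 CP] := sqr_1DpowR_le_expR s0.
have cvgI := @cvg_integral_powR_expRN s.
apply: (@le_lt_trans _ _ (C / s)%:E); last by rewrite ltry.
rewrite -(cvg_lim _ cvgI)//; apply: lime_le; first by apply/cvg_ex; eexists; exact: cvgI.
apply: nearW => n.
(* [F'] dominates the integrand since (1 + t^s)^2 <= C e^t, and its antiderivative [F] takes values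
   between - C / s and 0. *)
pose F t := C / s * - (1 + powR t s)^-1.
pose F' t := C / s * (s * powR t (s - 1) / (1 + powR t s) ^+ 2).
have dF' t : 0 < t -> derivable F' t 1.
  by move=> t0; apply: derivableM => //; exact: derivable_dV1DpowR.
apply: (@le_trans _ _ (\int[mu]_(t in `[(n.+2%:R^-1)%R, n.+2%:R%R]) (F' t)%:E)%E).
  apply: le_integral => //.
  - by apply: itv_integrable => t /invSS_gt0; exact: derivable_powR_expRN.
  - by apply: itv_integrable => t /invSS_gt0; exact: dF'.
  move=> t; rewrite inE/= in_itv/= => /invSS_gt0 t0; rewrite lee_fin /F'.
  have p0 : 0 < 1 + powR t s by rewrite ltr_pwDl// powR_ge0.
  rewrite [leRHS](_ : _ = powR t (s - 1) * (C / (1 + powR t s) ^+ 2)); last first.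
    by field; rewrite !gt_eqF.
  rewrite ler_wpM2l ?powR_ge0// ler_pdivlMr ?exprn_gt0//.
  by rewrite expRN ler_pdivrMl ?expR_gt0// mulrC CP.
have dF t : n.+2%:R^-1 <= t <= n.+2%:R -> is_derive t 1 F (F' t).
  move=> /invSS_gt0 t0; have dV := is_derive_V1DpowR s t0.
  exact: (is_deriveZ (C / s)).
rewrite (@integral_is_derive _ _ _ _ _ (invSS_lt n) dF); last first.
  by move=> t /invSS_gt0; exact: dF'.
rewrite lee_fin /F; set x := (_.+2)%:R; set y := x^-1.
have : (1 + powR y s)^-1 <= 1.
  by rewrite invf_le1 ?lerDl ?powR_ge0// ltr_pwDl// powR_ge0.
have : 0 < (1 + powR x s)^-1 by rewrite invr_gt0 ltr_pwDl// powR_ge0.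
have : 0 < C / s by rewrite divr_gt0.
by nra.
Qed.

(** On [1, 2] the integrand is at least e^(-2) / 2, because t^(s-1) >= 1 / t >= 1 / 2 there. *)
Lemma Gamma_gt0 s : 0 < s -> 0 < Gamma s.
Proof.
move=> s0; rewrite -lte_fin -EFin_Gamma//.
apply: (@lt_le_trans _ _ (\int[mu]_(t in `[1%R, 2%R]) (expR (- 2) / 2)%:E)%E).
  by rewrite integral_cst//= lebesgue_measure_itv/= lte_fin ltr1n -EFinB -EFinM lte_fin
    mulr_gt0 ?divr_gt0 ?expR_gt0// subr_gt0 ltr1n.
apply: (@le_trans _ _ (\int[mu]_(t in `[1%R, 2%R]) (powR t (s - 1) * expR (- t))%:E)%E).
  have gt0 t : 1 <= t <= 2 -> 0 < t by move=> /andP[]; lra.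
  apply: le_integral => //.
  - exact: itv_integrable.
  - by apply: itv_integrable => t /gt0; exact: derivable_powR_expRN.
  move=> t; rewrite inE/= in_itv/= => t12; rewrite lee_fin mulrC.
  have /andP[t1 t2] := t12.
  have t0 := gt0 _ t12.
  apply: ler_pM; rewrite ?expR_ge0 ?ler_expR ?lerN2 ?invr_ge0//.
  rewrite powRB; last by rewrite (gt_eqF t0) implybT.
  rewrite powRr1 ?(ltW t0)// ler_pdivlMr//.
  have : 1 <= powR t s by rewrite -(powRr0 t) ler_powR// ltW.
  lra.
apply: ge0_subset_integral => //.
- apply/measurable_EFinP/measurable_funTS; apply: measurable_funM.
    exact: measurable_powR.
  by apply: measurableT_comp; [exact: measurable_expR|exact: oppr_measurable].
- by move=> t _; rewrite lee_fin mulr_ge0 ?powR_ge0 ?expR_ge0.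
- by move=> t; rewrite /= !in_itv/= andbT => /andP[]; lra.
Qed.

Lemma cvg_Gamma s : 0 < s ->
  \int[mu]_(t in `[n.+2%:R^-1, n.+2%:R]) (powR t (s - 1) * expR (- t))
    @[n --> \oo] --> Gamma s.
Proof.
by move=> s0; apply: fine_cvg; rewrite -EFin_Gamma//; exact: cvg_integral_powR_expRN.
Qed.

(** Integration by parts: the derivative of t^s e^(-t) is integrated over the segments
    [1/(n+2), n+2], and the boundary terms vanish in the limit. *)
Lemma GammaS s : 0 < s -> Gamma (s + 1) = s * Gamma s.
Proof.
move=> s0; pose I x n :=
  \int[mu]_(t in `[n.+2%:R^-1, n.+2%:R]) (powR t (x - 1) * expR (- t)).
pose F t := powR t s * expR (- t).
have IF n : s * I s n - I (s + 1) n = F n.+2%:R - F n.+2%:R^-1.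
  rewrite -RintegralZl//; last first.
    by apply: itv_integrable => t /invSS_gt0; exact: derivable_powR_expRN.
  rewrite -RintegralB//=; last 2 first.
  - apply: itv_integrable => t /invSS_gt0 ?; apply: derivableM => //.
    exact: derivable_powR_expRN.
  - by apply: itv_integrable => t /invSS_gt0; exact: derivable_powR_expRN.
  have dF t : n.+2%:R^-1 <= t <= n.+2%:R -> is_derive t 1 F
      (s * (powR t (s - 1) * expR (- t)) - powR t s * expR (- t)).
    by move=> /invSS_gt0; exact: is_derive_powR_expRN.
  rewrite /Rintegral addrK (@integral_is_derive _ _ _ _ _ (invSS_lt n) dF)//.
  move=> t /invSS_gt0 t0; apply: derivableB; last exact: derivable_powR_expRN.
  by apply: derivableM => //; exact: derivable_powR_expRN.
have s10 : 0 < s + 1 by rewrite addr_gt0.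
have cF : s * I s n - I (s + 1) n @[n --> \oo] --> s * Gamma s - Gamma (s + 1).
  by apply: cvgB; [apply: cvgMr|]; exact: cvg_Gamma.
apply/esym/eqP; rewrite -subr_eq0; apply/eqP; apply: (cvg_unique _ cF) => //.
have [C C0 CP] := sqr_1DpowR_le_expR s0.
have cp : powR n.+2%:R^-1 s @[n --> \oo] --> (0 : R).
  have /cvg_at_rightP := powR_cvg0 s0; apply.
  by split => //; exact: cvg_invSS.
have cC : C * powR n.+2%:R^-1 s @[n --> \oo] --> (0 : R).
  by rewrite -(mulr0 C); exact: cvgMr.
(* With x = n + 2, the lower boundary term is at most x^(-s) since e^(-1/x) <= 1, and the upper one
   is at most C x^(-s) since x^(2s) <= C e^x. *)
apply: (@squeeze_cvgr _ _ _ _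
  (fun n => - powR n.+2%:R^-1 s) (fun n => C * powR n.+2%:R^-1 s)) => //.
  apply: nearW => n; rewrite IF.
  have F0 t : 0 <= F t by rewrite mulr_ge0 ?powR_ge0 ?expR_ge0.
  have Fle : F n.+2%:R^-1 <= powR n.+2%:R^-1 s.
    by rewrite ler_piMr ?powR_ge0// -expR0 ler_expR oppr_le0.
  have : F n.+2%:R <= C * powR n.+2%:R^-1 s.
    have := CP n.+2%:R (ltr0Sn _ _).
    rewrite -powR_inv1// -powRrM mulN1r powRN /F expRN.
    have : 0 < powR (n.+2%:R : R) s by rewrite powR_gt0.
    have : 0 < expR (n.+2%:R : R) by rewrite expR_gt0.
    set P := powR _ s; set E := expR _ => E0 P0 CE.
    rewrite ler_pdivrMr// mulrAC ler_pdivlMr// -expr2.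
    by apply: le_trans CE; nra.
  by have := F0 n.+2%:R; have := F0 n.+2%:R^-1; lra.
by rewrite -oppr0; exact: cvgN.
Qed.

End gamma.

(** * Change of variables by reflection *)

Section estimates.
Context {R : realType}.
Set Implicit Arguments.
Unset Strict Implicit.
Implicit Types (f : R -> R) (a e k q s t x y z K : R).
Local Notation mu := (@lebesgue_measure R).

Lemma measurable_reflection k :
  measurable_fun [set: measurableTypeR R] (fun t => k - t : measurableTypeR R).
Proof. by apply: measurable_funB. Qed.

(** Lebesgue measure is determined by the lengths of half-open intervals, and a reflection turns
    []x, y]] into an interval of the same length. *)
Lemma lebesgue_measure_reflection k (A : set (measurableTypeR R)) : measurable A ->
  pushforward mu (fun t => k - t : measurableTypeR R) A = mu A.
Proof.
move=> mA.
pose phi : {mfun (measurableTypeR R) >-> (measurableTypeR R)} :=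
  HB.pack (fun t : measurableTypeR R => k - t : measurableTypeR R)
          (isMeasurableFun.Build _ _ _ _ _ (measurable_reflection k)).
rewrite (_ : (fun t => k - t : measurableTypeR R) = phi)//.
apply/esym/lebesgue_measure_unique => //= _ [[x y]] _ <-.
rewrite /pushforward (_ : _ @^-1` _ = `[k - y, k - x[%classic).
  by rewrite !lebesgue_measure_itv/= !lte_fin ltrD2l ltrN2 -!EFinB;
    case: ifP => // _; congr EFin; ring.
apply/seteqP; split => t; rewrite /= !in_itv/= => /andP[]; lra.
Qed.

(** Only measurability is assumed, so the singular kernels of the fractional integrals are covered.
    Nonnegative functions are handled by the pushforward measure, the general case by positive and
    negative parts. *)
Lemma integral_reflection k x y (f : R -> \bar R) : measurable_fun `[x, y] f ->
  (\int[mu]_(t in `[x, y]) f t = \int[mu]_(t in `[(k - y)%R, (k - x)%R]) f (k - t)%R)%E.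
Proof.
move=> mf.
have D : (fun t => k - t) @^-1` `[x, y]%classic = `[k - y, k - x]%classic :> set R.
  by apply/seteqP; split => t; rewrite /= !in_itv/= => /andP[]; lra.
have ge0 (g : R -> \bar R) : measurable_fun `[x, y] g -> (forall t, 0 <= g t)%E ->
    (\int[mu]_(t in `[x, y]) g t = \int[mu]_(t in `[(k - y)%R, (k - x)%R]) g (k - t)%R)%E.
  move=> mg g0; rewrite -D.
  rewrite -(@ge0_integral_pushforward _ _ _ _ _ _ (measurable_reflection k) mu _ g)//.
  apply: eq_measure_integral => [|? B mB _]; first exact: measurable_reflection.
  by apply/esym; exact: lebesgue_measure_reflection.
rewrite [LHS]integralE [RHS]integralE ge0; [|exact: measurable_funepos|by []].
rewrite ge0; [|exact: measurable_funeneg|by []].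
by congr (_ - _)%E; apply: eq_integral => t _; rewrite ?funeposE ?funenegE.
Qed.

Lemma Rintegral_reflection k x y f : measurable_fun `[x, y] f ->
  \int[mu]_(t in `[x, y]) f t = \int[mu]_(t in `[k - y, k - x]) f (k - t).
Proof.
by move=> mf; rewrite /Rintegral (@integral_reflection k)//; exact/measurable_EFinP.
Qed.

(** * Integrals over [0, e] with weight t^(s-1) *)

Lemma integrable_powR s e : 0 < s -> 0 < e ->
  mu.-integrable `[0, e] (fun t => (powR t (s - 1))%:E).
Proof.
move=> s0 e0; apply/integrableP; split.
  by apply/measurable_EFinP/measurable_funTS; exact: measurable_powR.
under eq_integral do rewrite gee0_abs ?lee_fin ?powR_ge0//.
by rewrite integral_powR// ltry.
Qed.

Lemma Rintegral_powR s e : 0 < s -> 0 < e ->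
  \int[mu]_(t in `[0, e]) powR t (s - 1) = powR e s / s.
Proof. by move=> s0 e0; rewrite /Rintegral integral_powR. Qed.

Lemma integrable_powRM s e f : 0 < s -> 0 < e ->
  measurable_fun `[0, e] f -> [bounded f t | t in `[0, e]] ->
  mu.-integrable `[0, e] (EFin \o (fun t => powR t (s - 1) * f t)).
Proof.
move=> s0 e0 mf bf.
have mD : measurable (`[0, e]%classic : set (measurableTypeR R)) by [].
have := integrableMl mD (integrable_powR s0 e0) mf bf.
by apply: eq_integrable.
Qed.

Lemma integrable_powRM_derivable s e f : 0 < s -> 0 < e ->
  (forall t, 0 <= t <= e -> derivable f t 1) ->
  mu.-integrable `[0, e] (EFin \o (fun t => powR t (s - 1) * f t)).
Proof.
move=> s0 e0 df; apply: integrable_powRM => //.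
  exact: measurable_derivable.
have /compact_bounded[M [_ mrt]] :=
  continuous_compact (derivable_within_itv df) (@segment_compact R 0 e).
by exists M; split; rewrite ?num_real // => ? ? ? ?; exact: mrt.
Qed.

Lemma integrable_powR_min s e : 0 < s -> 0 < e ->
  mu.-integrable `[0, e]
    (EFin \o (fun t => powR t (s - 1) * Num.min t (e - t))).
Proof.
move=> s0 e0.
have mmin : measurable_fun `[0, e] (fun t => Num.min t (e - t)).
  by apply: measurable_minr => //; apply: measurable_funB.
have bmin : [bounded Num.min t (e - t) | t in `[0, e]].
  exists e; split; first exact: num_real.
  move=> M eM t /=; rewrite in_itv/= => /andP[t0 te].
  rewrite ger0_norm; last by rewrite le_min t0 subr_ge0.
  by rewrite ge_min (le_trans te)// ltW.
exact: integrable_powRM.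
Qed.

(** Splitting at e / 2, where the minimum changes branch, produces the factor 1 - 2^(-s) of the
    final constant. *)
Lemma Rintegral_powR_min s e : 0 < s -> 0 < e ->
  \int[mu]_(t in `[0, e]) (powR t (s - 1) * Num.min t (e - t)) =
  powR e (s + 1) * (1 - (powR 2 s)^-1) / (s * (s + 1)).
Proof.
move=> s0 e0; have s10 : 0 < s + 1 by lra.
have m0 : 0 < e / 2 by lra.
(* This includes [t = 0]: as [s > 0], both sides vanish there, whatever value [powR 0 (s - 1)]
   takes. *)
have powRS t : 0 <= t -> powR t (s - 1) * t = powR t (s + 1 - 1).
  by move=> t0; rewrite addrK mulrC mulr_powRB1.
have iI x : 0 < x -> mu.-integrable `[0, e] (fun t => (powR t (x - 1))%:E).
  by move=> x0; exact: integrable_powR.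
have imin := integrable_powR_min s0 e0.
rewrite (_ : `[0, e]%classic = `[0, e / 2]%classic `|` `]e / 2, e]%classic); last first.
  by rewrite -itv_bndbnd_setU// bnd_simp; lra.
have half x : 0 < x -> \int[mu]_(t in `]e / 2, e]) powR t (x - 1) =
    powR e x / x - powR (e / 2) x / x.
  move=> x0; rewrite -!Rintegral_powR//.
  by rewrite (Rintegral_itvB (iI x x0)) ?bnd_simp//; lra.
rewrite Rintegral_setU//; last 2 first.
- by rewrite -itv_bndbnd_setU// bnd_simp; lra.
- apply/disj_setPS => t [] /=; rewrite !in_itv/= => /andP[_ t1] /andP[t2 _].
  by move: t1; rewrite leNgt t2.
have -> : \int[mu]_(t in `[0, e / 2]) (powR t (s - 1) * Num.min t (e - t)) =
    \int[mu]_(t in `[0, e / 2]) powR t (s + 1 - 1).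
  apply: eq_Rintegral => t; rewrite inE/= in_itv/= => /andP[t0 te].
  by rewrite min_l ?powRS//; lra.
have -> : \int[mu]_(t in `]e / 2, e]) (powR t (s - 1) * Num.min t (e - t)) =
    \int[mu]_(t in `]e / 2, e]) (e * powR t (s - 1) - powR t (s + 1 - 1)).
  apply: eq_Rintegral => t; rewrite inE/= in_itv/= => /andP[t0 te].
  by rewrite min_r -?powRS; [ring|lra|lra].
have iH x : 0 < x -> mu.-integrable `]e / 2, e] (fun t => (powR t (x - 1))%:E).
  move=> x0; apply: integrableS (iI _ x0) => // t /=; rewrite !in_itv/=.
  by move=> /andP[]; lra.
rewrite RintegralB//; last 2 first.
- under [X in _.-integrable _ X]eq_fun do rewrite /= EFinM.
  by apply: integrableZl => //; exact: iH.
- exact: iH.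
rewrite RintegralZl//; last exact: iH.
rewrite !half// Rintegral_powR//.
have p2 : 0 < powR 2 s :> R by rewrite powR_gt0.
have powRD1 x : 0 < x -> powR x (s + 1) = powR x s * x.
  by move=> x0; rewrite powRD ?powRr1 ?ltW// (gt_eqF x0) implybT.
rewrite !powRD1// powRM ?invr_ge0 ?ltW//.
have -> : powR 2^-1 s = (powR 2 s)^-1 :> R.
  by rewrite -powR_inv1// -powRrM mulN1r powRN.
by field; rewrite !gt_eqF.
Qed.

(** * Power mean inequality and bound on the symmetric difference *)

Lemma powR_mean_le q x y z : 1 < q -> 0 <= x -> 0 <= y ->
  powR x q + powR y q <= z -> x + y <= 2 * powR (z / 2) q^-1.
Proof.
move=> q1 x0 y0 xyz; have q0 : 0 < q by lra.
(* Convexity of the q-th power at the midpoint; taking q-th roots then gives the claim. *)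
have cvx : powR ((x + y) / 2) q <= (powR x q + powR y q) / 2.
  have h : 0 <= (2^-1 : R) <= 1 by apply/andP; split; lra.
  have := @convex_powR R q (ltW q1) (Itv01 (andP h).1 (andP h).2) x y.
  rewrite !inE /= !in_itv /= !andbT => /(_ x0 y0) cq.
  rewrite convRE [X in powR X _ <= _]convRE /= /unstable.onem in cq.
  rewrite (_ : 2^-1 * x + (1 - 2^-1) * y = (x + y) / 2) in cq; last by lra.
  by lra.
rewrite -ler_pdivrMl// mulrC.
have xy0 : 0 <= (x + y) / 2 by lra.
rewrite [leLHS](_ : _ = powR (powR ((x + y) / 2) q) q^-1); last first.
  by rewrite -powRrM mulfV ?powRr1// lt0r_neq0.
apply: ge0_ler_powR.
- by rewrite invr_ge0 ltW.
- by rewrite nnegrE powR_ge0.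
- rewrite nnegrE; have := powR_ge0 x q; have := powR_ge0 y q; lra.
- by apply: le_trans cvx _; lra.
Qed.

(** The derivative of the symmetric difference at t is f'(a + e - t) - f'(a + t), so a bound on the
    sum of |f'| at two mirror points is what the mean value theorem calls for; it requires no
    continuity of f'. *)
Lemma symmetric_difference_le f a e K : 0 < e ->
  (forall t, a <= t <= a + e -> derivable f t 1) ->
  (forall t, 0 <= t <= e -> `|derive1 f (a + t)| + `|derive1 f (a + e - t)| <= 2 * K) ->
  forall t, 0 <= t <= e ->
    `|f a + f (a + e) - (f (a + e - t) + f (a + t))| <= 2 * K * Num.min t (e - t).
Proof.
move=> e0 df fK.
pose g t := f a + f (a + e) - (f (a + e - t) + f (a + t)).
have dg t : 0 <= t <= e -> is_derive t 1 g (derive1 f (a + e - t) - derive1 f (a + t)).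
  move=> te.
  have d1 : is_derive (a + t) 1 f (derive1 f (a + t)).
    by rewrite derive1E; apply/derivableP/df; lra.
  have d2 : is_derive (a + e - t) 1 f (derive1 f (a + e - t)).
    by rewrite derive1E; apply/derivableP/df; lra.
  have s1 : is_derive t 1 (fun t => a + t) 1.
    by have := is_deriveD (is_derive_cst a t 1) (is_derive_id t 1); rewrite add0r.
  have s2 : is_derive t 1 (fun t => a + e - t) (- 1).
    by have := is_deriveB (is_derive_cst (a + e) t 1) (is_derive_id t 1); rewrite sub0r.
  have := is_deriveB (is_derive_cst (f a + f (a + e)) t 1)
    (is_deriveD (@is_derive1_comp R f (fun t => a + e - t) t _ _ d2 s2)
      (@is_derive1_comp R f (fun t => a + t) t _ _ d1 s1)).
  by move=> dsum; apply: (is_derive_eq dsum); ring.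
have gle t : 0 <= t <= e -> `|g t| <= 2 * K * t.
  move=> te; have [t0 te'] := andP te.
  have [| |x] := @MVT_segment R g (fun t => derive1 f (a + e - t) - derive1 f (a + t)) 0 t t0.
  - by move=> x; rewrite in_itv/= => /andP[x0 xt]; apply: dg; lra.
  - apply: derivable_within_itv => x /andP[x0 xt].
    by have [] : is_derive x 1 g (derive1 f (a + e - x) - derive1 f (a + x)) by apply: dg; lra.
  rewrite in_itv/= => /andP[x0 xt].
  rewrite {2}/g subr0 addr0 (addrC (f (a + e))) subrr !subr0 => ->.
  rewrite normrM (ger0_norm t0) ler_wpM2r//.
  by rewrite (le_trans (ler_normB _ _))// addrC fK//; lra.
(* Past the midpoint the minimum is [e - t], and the symmetry of [g] transfers the bound from
   [e - t] to [t]. *)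
move=> t te; rewrite -/(g t); have [t2|t2] := leP t (e - t); first exact: gle.
have -> : g t = g (e - t).
  rewrite /g (_ : a + e - (e - t) = a + t); last by ring.
  by rewrite (_ : a + (e - t) = a + e - t) ?(addrC (f (a + t)))//; ring.
by apply: gle; lra.
Qed.

(** * Fractional integrals brought to a common kernel on [0, e] *)

Lemma derivable_reflection f k t : derivable f (k - t) 1 ->
  derivable (fun u => f (k - u)) t 1.
Proof.
move=> /derivableP df.
have s2 : is_derive t 1 (fun t => k - t) (- 1).
  by have := is_deriveB (is_derive_cst k t 1) (is_derive_id t 1); rewrite sub0r.
by have [] := @is_derive1_comp R f (fun t => k - t) t _ _ df s2.
Qed.

Lemma derivable_translation f k t : derivable f (k + t) 1 ->
  derivable (fun u => f (k + u)) t 1.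
Proof.
move=> /derivableP df.
have s1 : is_derive t 1 (fun t => k + t) 1.
  by have := is_deriveD (is_derive_cst k t 1) (is_derive_id t 1); rewrite add0r.
by have [] := @is_derive1_comp R f (fun t => k + t) t _ _ df s1.
Qed.

Lemma measurable_powRBM f k s x y : measurable_fun `[x, y] f ->
  measurable_fun `[x, y] (fun t => powR (k - t) s * f t).
Proof.
move=> mf; apply: measurable_funM => //; apply: measurable_funTS.
exact: (measurableT_comp (measurable_powR s) (measurable_reflection k)).
Qed.

(** Reflecting in a + e moves the singularity of the kernel to 0, where the right-sided integral
    will have it as well. *)
Lemma RL_left_reflection s a e f :
  (forall t, a <= t <= a + e -> derivable f t 1) ->
  RL_left s a f (a + e) =
  (Gamma s)^-1 * \int[mu]_(t in `[0, e]) (powR t (s - 1) * f (a + e - t)).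
Proof.
move=> df; rewrite /RL_left (@Rintegral_reflection (a + e)); last first.
  by apply: measurable_powRBM; exact: measurable_derivable.
rewrite subrr (_ : a + e - a = e); last by ring.
by apply: (congr1 ( *%R _)); apply: eq_Rintegral => t _; rewrite subKr.
Qed.

(** The translation by [a] is composed of two reflections, with constants [a + e] and [e], so that
    [Rintegral_reflection] serves here too. *)
Lemma RL_right_translation s a e f :
  (forall t, a <= t <= a + e -> derivable f t 1) ->
  RL_right s (a + e) f a =
  (Gamma s)^-1 * \int[mu]_(t in `[0, e]) (powR t (s - 1) * f (a + t)).
Proof.
move=> df; rewrite /RL_right (@Rintegral_reflection (a + e)); last first.
  apply: measurable_funM; last exact: measurable_derivable.
  apply: measurable_funTS.
  have mB : measurable_fun [set: R] (fun t => t - a) by exact: measurable_funB.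
  exact: (measurableT_comp (measurable_powR (s - 1)) mB).
rewrite subrr (_ : a + e - a = e); last by ring.
rewrite (@Rintegral_reflection e); last first.
  rewrite (_ : (fun t => _) = fun t => powR (e - t) (s - 1) * f (a + e - t));
    last by apply/funext => t; rewrite addrAC (addrAC a) subrr add0r.
  apply: measurable_powRBM; apply: measurable_derivable => t te.
  by apply: derivable_reflection; apply: df; lra.
rewrite subrr subr0; apply: (congr1 ( *%R _)); apply: eq_Rintegral => t _.
have -> : a + e - (e - t) = a + t by ring.
by rewrite addrAC subrr add0r.
Qed.

End estimates.

(** * The trapezoid inequality for Riemann-Liouville integrals *)

Theorem theorem2p5 (R : realType) (A : set R) (eta : R -> R -> R) (a b : R)
  (f : R -> R) (p q alpha : R) :
  open A -> invex A eta ->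
  A a -> A b -> a < a + eta b a ->
  (forall x, A x -> derivable f x 1) ->
  (@lebesgue_measure R).-integrable `[a, a + eta b a] (EFin \o (derive1 f)) ->
  preinvex A eta (fun x => powR `|(derive1 f) x| q) ->
  1 < q -> p^-1 + q^-1 = 1 -> 0 < alpha ->
  `| (f a + f (a + eta b a)) / 2
     - Gamma (alpha + 1) / (2 * powR (eta b a) alpha)
       * (RL_left alpha a f (a + eta b a) + RL_right alpha (a + eta b a) f a) |
  <= eta b a / (alpha + 1) * (1 - (powR 2 alpha)^-1)
     * powR ((powR `|(derive1 f) a| q + powR `|(derive1 f) b| q) / 2) q^-1.
Proof.
move=> _ invA Aa Ab; set e := eta b a => ae dfA _ preA q1 _ al0.
have e0 : 0 < e by lra.
have en0 := lt0r_neq0 e0.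
set z := powR _ q + powR _ q; set K := powR (z / 2) q^-1.
have df t : a <= t <= a + e -> derivable f t 1.
  move=> /andP[t1 t2]; apply: dfA.
  (* Invexity from [a] towards [b] with parameter [(t - a) / e] puts the whole segment inside
     [A]. *)
  rewrite (_ : t = a + (t - a) / e * e); last by rewrite (divfK en0); ring.
  by apply: invA => //; rewrite divr_ge0 ?ler_pdivrMr ?mul1r//; lra.
have preE u : 0 <= u <= 1 -> powR `|derive1 f (a + u * e)| q <=
    (1 - u) * powR `|derive1 f a| q + u * powR `|derive1 f b| q.
  by move=> u01; exact: preA.
(* At the mirror parameters [u] and [1 - u] the weights of each endpoint add up to 1, so the summed
   preinvexity bound is free of [u]. *)
have lin (u P Q : R) :
    (1 - u) * P + u * Q + ((1 - (1 - u)) * P + (1 - u) * Q) = P + Q by ring.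
have fK t : 0 <= t <= e -> `|derive1 f (a + t)| + `|derive1 f (a + e - t)| <= 2 * K.
  move=> /andP[t0 te].
  apply: (powR_mean_le q1 (normr_ge0 _) (normr_ge0 _)).
  have u01 : 0 <= t / e <= 1 by rewrite divr_ge0 ?ler_pdivrMr ?mul1r//; lra.
  have v01 : 0 <= 1 - t / e <= 1 by lra.
  have hu := preE _ u01; rewrite (divfK en0) in hu.
  have hv := preE _ v01; rewrite mulrBl mul1r (divfK en0) addrA in hv.
  by apply: le_trans (lerD hu hv) _; rewrite lin.
have dR t : 0 <= t <= e -> derivable (fun t => f (a + t)) t 1.
  by move=> te; apply: derivable_translation; apply: df; lra.
have dL t : 0 <= t <= e -> derivable (fun t => f (a + e - t)) t 1.
  by move=> te; apply: derivable_reflection; apply: df; lra.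
have iL := integrable_powRM_derivable al0 e0 dL.
have iR := integrable_powRM_derivable al0 e0 dR.
have iC := integrable_powRM_derivable al0 e0 (fun t _ => derivable_cst (f a + f (a + e)) t 1).
have iM := integrable_powR_min al0 e0.
pose G t := f a + f (a + e) - (f (a + e - t) + f (a + t)).
have dG t : 0 <= t <= e -> derivable G t 1.
  move=> te; apply: derivableB; first exact: derivable_cst.
  by apply: derivableD; [exact: dL|exact: dR].
have iS := integrable_powRM_derivable al0 e0 (fun t te => derivableD (dL t te) (dR t te)).
have iG := integrable_powRM_derivable al0 e0 dG.
have p0 : 0 < powR e alpha by rewrite powR_gt0.
have IG : \int[@lebesgue_measure R]_(t in `[0, e]) (powR t (alpha - 1) * G t) =
    (f a + f (a + e)) * (powR e alpha / alpha) -
    (\int[@lebesgue_measure R]_(t in `[0, e]) (powR t (alpha - 1) * f (a + e - t)) +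
     \int[@lebesgue_measure R]_(t in `[0, e]) (powR t (alpha - 1) * f (a + t))).
  rewrite -Rintegral_powR// mulrC -RintegralZr//; last exact: integrable_powR.
  rewrite -RintegralD//.
  have eS : \int[@lebesgue_measure R]_(t in `[0, e])
      (powR t (alpha - 1) * f (a + e - t) + powR t (alpha - 1) * f (a + t)) =
    \int[@lebesgue_measure R]_(t in `[0, e])
      (powR t (alpha - 1) * (f (a + e - t) + f (a + t))).
    by apply: eq_Rintegral => t _; rewrite mulrDr.
  by rewrite eS -RintegralB//; apply: eq_Rintegral => t _; rewrite mulrBr.
(* The functional equation of Gamma cancels the normalisation 1 / Gamma(alpha), leaving the factor
   alpha; the constant part of [G] contributes e^alpha / alpha, which restores the trapezoid
   term. *)
have -> : (f a + f (a + e)) / 2 - Gamma (alpha + 1) / (2 * powR e alpha) *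
    (RL_left alpha a f (a + e) + RL_right alpha (a + e) f a) =
    alpha / (2 * powR e alpha) *
    \int[@lebesgue_measure R]_(t in `[0, e]) (powR t (alpha - 1) * G t).
  rewrite RL_left_reflection// RL_right_translation// IG GammaS//.
  by field; rewrite !gt_eqF// Gamma_gt0.
have c0 : 0 < alpha / (2 * powR e alpha) by rewrite divr_gt0 ?mulr_gt0.
rewrite normrM (gtr0_norm c0).
(* The target bound is rewritten as the same prefactor times an integral, so that it remains to
   compare integrands pointwise. *)
have -> : e / (alpha + 1) * (1 - (powR 2 alpha)^-1) * K =
    alpha / (2 * powR e alpha) * (2 * K *
      \int[@lebesgue_measure R]_(t in `[0, e]) (powR t (alpha - 1) * Num.min t (e - t))).
  rewrite Rintegral_powR_min// powRD; last by rewrite (gt_eqF e0) implybT.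
  rewrite powRr1 ?(ltW e0)//.
  field; rewrite !gt_eqF ?powR_gt0 ?addr_gt0//.
rewrite ler_pM2l//.
apply: le_trans (le_normr_Rintegral _ iG) _ => //.
rewrite -RintegralZl//; apply: le_Rintegral => //.
- exact: integrable_norm iG.
- by under [X in _.-integrable _ X]eq_fun do rewrite /= EFinM; apply: integrableZl.
move=> t /=; rewrite in_itv/= => te.
rewrite normrM (ger0_norm (powR_ge0 _ _)) mulrCA ler_wpM2l ?powR_ge0//.
exact: symmetric_difference_le.
Qed.
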